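(* Let $p,q\geq 3$ be integers with $p\neq 5$ and $q\neq 5$. Then $s_5(C_p\square C_q)=4$.
   Context: $P_k$ denotes the path on $k$ vertices, $C_k$ the cycle on $k$ vertices, and $\square$ denotes the Cartesian product of graphs. A $P_k$-coloring of a graph $G$ is a proper vertex coloring of $G$ in which no copy of $P_k$ in $G$ (as a subgraph, not necessarily induced) is bicolored, i.e. has its vertices colored using only two colors. The $P_k$-chromatic number $s_k(G)$ is the minimum number of colors in a $P_k$-coloring of $G$. *)

(* Defs.v *)
(* MathComp. A finite simple graph is a symmetric irreflexive relation [e] on a
   finType [T]. *)
From mathcomp Require Import all_boot.
Set Implicit Arguments.
Unset Strict Implicit.
Unset Printing Implicit Defensive.

Definition path_rel (k : nat) : rel 'I_k :=
  [rel i j : 'I_k | (j == i.+1 :> nat) || (i == j.+1 :> nat)].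

(* This is the simple graph C_n only for 3 <= n: it has a loop for n = 1 and is
   a single edge for n = 2. *)
Definition cycle_rel (n : nat) : rel 'I_n :=
  [rel i j : 'I_n | (i.+1 == j %[mod n]) || (j.+1 == i %[mod n])].

Definition box_rel (T1 T2 : finType) (e1 : rel T1) (e2 : rel T2) :
    rel (T1 * T2) :=
  [rel x y : T1 * T2 | (x.1 == y.1) && e2 x.2 y.2 || e1 x.1 y.1 && (x.2 == y.2)].

Lemma path_rel_sym k : symmetric (@path_rel k).
Proof. by move=> i j; rewrite /path_rel /= orbC. Qed.

Lemma path_rel_irr k : irreflexive (@path_rel k).
Proof. by move=> i; rewrite /path_rel /= orbb ltn_eqF. Qed.

Lemma cycle_rel_sym n : symmetric (@cycle_rel n).
Proof. by move=> i j; rewrite /cycle_rel /= orbC. Qed.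

Lemma cycle_rel_irr n : 1 < n -> irreflexive (@cycle_rel n).
Proof.
move=> n1 i; rewrite /cycle_rel /= orbb -addn1 -[X in _ == X %[mod _]]addn0 eqn_modDl.
by rewrite mod0n modn_small.
Qed.

Lemma box_rel_sym (T1 T2 : finType) (e1 : rel T1) (e2 : rel T2) :
  symmetric e1 -> symmetric e2 -> symmetric (box_rel e1 e2).
Proof.
by move=> s1 s2 x y; rewrite /box_rel /= s1 s2 (eq_sym x.1) (eq_sym x.2).
Qed.

Lemma box_rel_irr (T1 T2 : finType) (e1 : rel T1) (e2 : rel T2) :
  irreflexive e1 -> irreflexive e2 -> irreflexive (box_rel e1 e2).
Proof. by move=> i1 i2 x; rewrite /box_rel /= i1 i2 !andbF. Qed.

Section PkColoring.
Variables (T : finType) (e : rel T).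

Definition proper_coloring (n : nat) (c : {ffun T -> 'I_n}) : bool :=
  [forall x, forall y, e x y ==> (c x != c y)].

(* A copy of P_k, not necessarily induced, is an injective graph homomorphism
   from P_k. *)
Definition path_copy (k : nat) (f : {ffun 'I_k -> T}) : bool :=
  injectiveb f && [forall i, forall j, path_rel i j ==> e (f i) (f j)].

(* In a proper coloring and for k >= 2, "at most two colors" is the same as
   "exactly two colors". *)
Definition bicolored (n k : nat) (c : {ffun T -> 'I_n})
    (f : {ffun 'I_k -> T}) : bool :=
  #|[set c (f i) | i : 'I_k]| <= 2.

Definition Pk_coloring (k n : nat) (c : {ffun T -> 'I_n}) : bool :=
  proper_coloring c &&
  [forall f : {ffun 'I_k -> T}, path_copy f ==> ~~ bicolored c f].

Definition Pk_colorable (k n : nat) : bool :=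
  [exists c : {ffun T -> 'I_n}, Pk_coloring k c].

(* The least n <= #|T| with [Pk_colorable k n], and #|T|.+1 if there is none.
   For k >= 3 an injective coloring is a P_k-coloring, so this is the minimum
   over all n: see [Pk_chromatic_numberP]. *)
Definition Pk_chromatic_number (k : nat) : nat :=
  find (Pk_colorable k) (iota 0 #|T|.+1).

Lemma Pk_colorable_card k : irreflexive e -> 3 <= k -> Pk_colorable k #|T|.
Proof.
move=> irr k3; apply/existsP; exists [ffun x => enum_rank x].
apply/andP; split.
  apply/forallP=> x; apply/forallP=> y; apply/implyP=> exy.
  rewrite !ffunE; apply: contraTneq exy => /enum_rank_inj ->.
  by rewrite irr.
apply/forallP=> f; apply/implyP=> /andP[/injectiveP injf _].
rewrite /bicolored -ltnNge card_imset ?card_ord // => i j.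
by rewrite !ffunE => /enum_rank_inj /injf.
Qed.

Lemma Pk_chromatic_numberP k m : irreflexive e -> 3 <= k ->
  Pk_chromatic_number k = m <->
  Pk_colorable k m /\ (forall n, Pk_colorable k n -> m <= n).
Proof.
move=> irr k3; have colT := Pk_colorable_card irr k3.
have hasC : has (Pk_colorable k) (iota 0 #|T|.+1).
  by apply/hasP; exists #|T|; rewrite // mem_iota add0n ltnSn.
have ltT : Pk_chromatic_number k < #|T|.+1.
  by rewrite /Pk_chromatic_number -[X in _ < X](size_iota 0) -has_find.
have colS : Pk_colorable k (Pk_chromatic_number k).
  by have := nth_find 0 hasC; rewrite nth_iota.
have minS n : Pk_colorable k n -> Pk_chromatic_number k <= n.
  move=> coln; rewrite leqNgt; apply/negP=> ltn.
  have := before_find 0 ltn; rewrite nth_iota ?add0n ?coln //.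
  exact: ltn_trans ltT.
split=> [<- // | [colm minm]].
by apply/eqP; rewrite eqn_leq minS // minm.
Qed.

End PkColoring.

(* Main.v *)
(* Lower bound: the 3 x 3 grid is a subgraph of the torus, and a finite check
   shows that it has no P_5-coloring with three colors. Upper bound: each of
   p and q is a sum of 3s and 4s, so each cycle has a homomorphism to the digraph
   0 -> 1 -> 2 -> 0, 2 -> 3 -> 0, and vertex (i, j) gets as color the sum of the
   images of i and j in the Klein four-group. A copy of P_5 lies within distance 2 of
   its middle vertex, so it remains to check all pairs of walks with 5 vertices
   in that digraph. *)
Require Import Defs.
From mathcomp Require Import all_boot.
From mathcomp Require Import zify.

Set Implicit Arguments.
Unset Strict Implicit.
Unset Printing Implicit Defensive.

(** * Enumerated words and alternating color sequences *)

Definition words (n k : nat) : seq (seq nat) :=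
  iter k (fun W => [seq x :: w | x <- iota 0 n, w <- W]) [:: [::]].

Lemma mem_words n k (w : seq nat) :
  (w \in words n k) = (size w == k) && all (gtn n) w.
Proof.
elim: k w => [|k IHk] [|x w] //=; first by apply/allpairsP=> -[[x u] [_ _]].
rewrite eqSS andbCA -IHk; apply/allpairsP/andP.
  by case=> -[y u] /= [ylt uW [-> ->]]; rewrite mem_iota in ylt.
by case=> xlt wW; exists (x, w); rewrite mem_iota.
Qed.

(** The color pattern of a bicolored P_5. Lists of any other length give [false], so statements
    about paths need no length condition. *)
Definition alternating (C : eqType) (s : seq C) : bool :=
  if s is [:: a; b; a'; b'; a''] then [&& a == a', a == a'' & b == b'] else false.

Lemma alternating_map (C D : eqType) (h : C -> D) (s : seq C) :
  injective h -> alternating (map h s) = alternating s.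
Proof.
by move=> injh; case: s => [|a [|b [|c [|d [|f [|? ?]]]]]] //=; rewrite !(inj_eq injh).
Qed.

(** * Copies of P_5 as lists of vertices *)

Section FivePaths.
Variables (T : finType) (e : rel T).

(** Consecutive colors differ, so with two colors available each color must equal the one two steps
    earlier. *)
Lemma bicolored_path_copyE n (c : {ffun T -> 'I_n}) (f : {ffun 'I_5 -> T}) :
    proper_coloring e c -> path_copy e f ->
  bicolored c f = alternating [seq c (f (inord k)) | k <- iota 0 5].
Proof.
move=> /forallP propc /andP[_ /forallP adjf].
have neq k : k < 4 -> c (f (inord k)) != c (f (inord k.+1)).
  move=> k4; have /forallP/(_ (f (inord k.+1)))/implyP := propc (f (inord k)).
  apply; have /forallP/(_ (inord k.+1))/implyP := adjf (inord k).
  by apply; rewrite /path_rel /= !inordK ?eqxx // ltnW.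
have im k : c (f (inord k)) \in [set c (f i) | i : 'I_5] by apply: imset_f.
move: (neq 0 isT) (neq 1 isT) (neq 2 isT) (neq 3 isT).
rewrite /bicolored /=; set A := [set _ | _ in _] in im *.
move=> n01 n12 n23 n34; apply/idP/idP => [cardA|]; last first.
  case/and3P=> /eqP h02 /eqP h04 /eqP h13.
  have sub : A \subset [set c (f (inord 0)); c (f (inord 1))].
    apply/subsetP=> _ /imsetP[i _ ->]; rewrite !inE -[i]inord_val.
    by case: i => -[|[|[|[|[|//]]]]] /= _; rewrite -?h02 -?h04 -?h13 eqxx ?orbT.
  by rewrite (leq_trans (subset_leq_card sub)) // cards2; case: (_ != _).
have third a b d : a \in A -> b \in A -> d \in A ->
    a != b -> b != d -> a = d.
  move=> aA bA dA nab nbd; apply: contraTeq cardA => nad; rewrite -ltnNge.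
  have : uniq [:: a; b; d] by rewrite /= !inE negb_or nab nad nbd.
  move/card_uniqP=> /= <-; apply/subset_leq_card/subsetP=> x.
  by rewrite !inE => /or3P[] /eqP->.
have e02 := third _ _ _ (im 0) (im 1) (im 2) n01 n12.
have e13 := third _ _ _ (im 1) (im 2) (im 3) n12 n23.
have e24 := third _ _ _ (im 2) (im 3) (im 4) n23 n34.
by rewrite -e24 -e02 -e13 !eqxx.
Qed.

(** Trades finite functions on ['I_5] for lists, the form in which the exhaustive checks are run.
    [sorted] gives each edge in one direction only; symmetry supplies the other. *)
Lemma P5_coloringP n (c : {ffun T -> 'I_n}) : symmetric e ->
  reflect ((forall x y, e x y -> c x != c y) /\
           (forall s, uniq s -> sorted e s -> ~~ alternating (map c s)))
          (Pk_coloring e 5 c).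
Proof.
move=> syme; apply: (iffP andP) => [[propc /forallP P5c] | [propc P5c]].
  split=> [x y exy | s us ss].
    by have /forallP/(_ x)/forallP/(_ y)/implyP := propc; apply.
  apply/negP=> alts; have sz : size s = 5.
    by case: s alts {us ss} => [|? [|? [|? [|? [|? [|? ?]]]]]].
  have x0 : T by case: s sz {us ss alts}.
  pose f : {ffun 'I_5 -> T} := [ffun i : 'I_5 => nth x0 s i].
  have pf : path_copy e f.
    apply/andP; split.
      apply/injectiveP=> i j; rewrite !ffunE => /eqP.
      by rewrite nth_uniq ?sz ?ltn_ord // => /eqP/val_inj.
    have adj (i j : 'I_5) : j = i.+1 :> nat -> e (f i) (f j).
      move=> ij; rewrite !ffunE ij; apply: (sortedP x0 ss).
      by rewrite -ij sz ltn_ord.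
    apply/forallP=> i; apply/forallP=> j; apply/implyP=> /orP[] /eqP ij.
      exact: adj.
    by rewrite syme; apply: adj.
  have /implyP/(_ pf)/negP := P5c f; apply.
  rewrite bicolored_path_copyE //; move: alts.
  rewrite -{1}[s](mkseq_nth x0) sz /mkseq -map_comp.
  by rewrite (@eq_in_map _ _ _ (fun k => c (f (inord k))) _).1 // => k;
    rewrite mem_iota /= ffunE => k5; rewrite inordK.
have propc' : proper_coloring e c.
  by apply/forallP=> x; apply/forallP=> y; apply/implyP; apply: propc.
split=> //; apply/forallP=> f; apply/implyP=> pf.
rewrite bicolored_path_copyE // (map_comp c (fun k => f (inord k))).
case/andP: pf => /injectiveP injf /forallP adjf; apply: P5c.
  rewrite map_inj_in_uniq ?iota_uniq // => i j; rewrite !mem_iota /= => i5 j5.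
  by move/injf/(congr1 val); rewrite /= !inordK.
have adj k : k < 4 -> e (f (inord k)) (f (inord k.+1)).
  move=> k4; have /forallP/(_ (inord k.+1))/implyP := adjf (inord k).
  by apply; rewrite /path_rel /= !inordK ?eqxx // ltnW.
by rewrite /= !adj.
Qed.

End FivePaths.

(** * Exhaustive search on the 3 x 3 grid *)

(* Vertex k stands for the cell (k %/ 3, k %% 3). *)
Definition grid3_adj : rel nat :=
  [rel u v | (u %/ 3 == v %/ 3) && ((u.+1 == v) || (v.+1 == u)) ||
             (u %% 3 == v %% 3) && ((u + 3 == v) || (v + 3 == u))].

Definition grid3_paths : seq (seq nat) :=
  [seq s <- words 9 5 | sorted grid3_adj s && uniq s].

Definition grid3_edges : seq (seq nat) :=
  [seq s <- words 9 2 | sorted grid3_adj s].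

Definition grid3_P5_coloring (w : seq nat) : bool :=
  all (fun s => uniq (map (nth 0 w) s)) grid3_edges &&
  all (fun s => ~~ alternating (map (nth 0 w) s)) grid3_paths.

(** Evaluates all 3^9 = 19683 color words. *)
Lemma grid3_no_P5_3coloring : ~~ has grid3_P5_coloring (words 3 9).
Proof. by vm_compute. Qed.

(** * Walks in the digraph and the check of 5 x 5 windows *)

Definition step : rel nat :=
  [rel x y | (x < 3) && (y == x.+1) || (1 < x) && (y == 0)].

(** The addition table of the Klein four-group, that is, bitwise exclusive or. *)
Definition tile (x y : nat) : nat :=
  nth 0 (nth [::] [:: [:: 0; 1; 2; 3];
                      [:: 1; 0; 3; 2];
                      [:: 2; 3; 0; 1];
                      [:: 3; 2; 1; 0]] x) y.

Definition windows : seq (seq nat) := [seq w <- words 4 5 | sorted step w].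

(* The truncated predecessor is harmless: only used at positive coordinates. *)
Definition nbrs (d : nat * nat) : seq (nat * nat) :=
  [:: (d.1.+1, d.2); (d.1.-1, d.2); (d.1, d.2.+1); (d.1, d.2.-1)].

Definition window_color (wx wy : seq nat) (d : nat * nat) : nat :=
  tile (nth 0 wx d.1) (nth 0 wy d.2).

(** Paths are grown outwards from the center (2, 2): first [d1] and [d3], then the ends [d0] and
    [d4]. Distinctness is asked of the offsets only, since on a short cycle distinct offsets may
    give the same vertex. *)
Definition window_ok (wx wy : seq nat) : bool :=
  all (fun d1 => (window_color wx wy (2, 2) != window_color wx wy d1) &&
    all (fun d3 => all (fun d0 => all (fun d4 =>
      let s := [:: d0; d1; (2, 2); d3; d4] in
      uniq s ==> ~~ alternating (map (window_color wx wy) s))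
    (nbrs d3)) (nbrs d1)) (nbrs (2, 2))) (nbrs (2, 2)).

(** There are nine windows, hence 81 pairs. *)
Lemma windows_ok : all (fun wx => all (window_ok wx) windows) windows.
Proof. by vm_compute. Qed.

Lemma tile_lt4 x y : tile x y < 4.
Proof.
by case: x => [|[|[|[|x]]]]; case: y => [|[|[|[|y]]]]; rewrite /tile /= ?nth_nil.
Qed.

(** The digraph has a 3-cycle and a 4-cycle through 0, and rounds of both can be concatenated there.
    The walk is periodic on [nat], so a window may start anywhere. *)
Lemma closed_step_walk n : 3 <= n -> n <> 5 ->
  exists phi : nat -> nat, [/\ forall i, phi i < 4,
    forall i, step (phi i) (phi i.+1) & forall i, phi (i %% n) = phi i].
Proof.
(* Each 4 accounts for one unit of [n %% 3]. The predecessors do not truncate: residue 1 forces n >=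
   4, and residue 2 forces n >= 8 as n is not 5. *)
move=> n3 n5; pose a := if n %% 3 == 0 then n %/ 3 else
  if n %% 3 == 1 then (n %/ 3).-1 else (n %/ 3).-2.
pose b := n %% 3.
have nE : n = 3 * a + 4 * b by rewrite /a /b; case: ifP => ?; [|case: ifP => ?]; lia.
have n0 : 0 < n by lia.
(* First [a] rounds of 0, 1, 2, then [b] rounds of 0, 1, 2, 3. *)
pose f i := if i < 3 * a then i %% 3 else (i - 3 * a) %% 4.
exists (fun i => f (i %% n)); split=> [i|i|i]; last by rewrite modn_mod.
  by rewrite /f; case: ifP => _; lia.
have i_n := ltn_pmod i n0; have := divn_eq i n.
set r := i %% n in i_n *; move=> iE.
have -> : i.+1 %% n = if r.+1 == n then 0 else r.+1.
  rewrite iE -addnS modnMDl; case: eqP => [->|ne]; first exact: modnn.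
  by apply: modn_small; lia.
have stepE x y : y = x.+1 /\ x < 3 \/ y = 0 /\ 1 < x -> step x y.
  by rewrite /step /= => -[[-> ->]|[-> ->]]; rewrite ?eqxx ?orbT.
apply: stepE; rewrite /f; case: (r.+1 =P n) => rn /=; do 2?case: ifP => ?; lia.
Qed.

(** Lifts a cycle edge to a unit move of the offset from [a]; positivity of [k] makes [k.-1] a true
    predecessor. *)
Lemma cycle_rel_lift n (u v : 'I_n) a k : 0 < k ->
    u = (a + k) %% n :> nat -> cycle_rel u v ->
  v = (a + k.+1) %% n :> nat \/ v = (a + k.-1) %% n :> nat.
Proof.
case: k => // k _ uE; have vn := ltn_ord v; rewrite /cycle_rel /= => /orP[]/eqP.
  by rewrite uE -addn1 modnDml addn1 -addnS (modn_small vn) => <-; left.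
rewrite uE modn_mod addnS -[v.+1]addn1 -[(a + k).+1]addn1 => /eqP.
by rewrite eqn_modDr (modn_small vn) => /eqP->; right.
Qed.

(** * The two bounds for the torus *)

Section Torus.
Variables (p q : nat) (p3 : 3 <= p) (q3 : 3 <= q).
Let torus := box_rel (@cycle_rel p) (@cycle_rel q).

Lemma torus_sym : symmetric torus.
Proof. by apply: box_rel_sym; apply: cycle_rel_sym. Qed.

Lemma torus_irr : irreflexive torus.
Proof. by apply: box_rel_irr; apply: cycle_rel_irr; apply: ltnW. Qed.

Lemma torus_P5_4colorable : p <> 5 -> q <> 5 -> Pk_colorable torus 5 4.
Proof.
move=> p5 q5.
have [phi [phi4 phiS phiM]] := closed_step_walk p3 p5.
have [psi [psi4 psiS psiM]] := closed_step_walk q3 q5.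
pose c : {ffun 'I_p * 'I_q -> 'I_4} :=
  [ffun x : 'I_p * 'I_q => Ordinal (tile_lt4 (phi x.1) (psi x.2))].
apply/existsP; exists c; apply/(P5_coloringP _ torus_sym).
have p0 : 0 < p by lia.
have q0 : 0 < q by lia.
pose pos a b (d : nat * nat) : 'I_p * 'I_q :=
  (Ordinal (ltn_pmod (a + d.1) p0), Ordinal (ltn_pmod (b + d.2) q0)).
have lift a b d v : 0 < d.1 -> 0 < d.2 -> torus (pos a b d) v ->
    exists2 d', d' \in nbrs d & v = pos a b d'.
  case: v => v1 v2 d10 d20; case/orP=> /andP[] /= => [/eqP <- r|r /eqP <-].
    case: (cycle_rel_lift (a := b) d20 _ r) => // vE;
      [exists (d.1, d.2.+1) | exists (d.1, d.2.-1)];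
      rewrite ?inE ?eqxx ?orbT //; congr pair; exact: val_inj.
  case: (cycle_rel_lift (a := a) d10 _ r) => // vE;
      [exists (d.1.+1, d.2) | exists (d.1.-1, d.2)];
    rewrite ?inE ?eqxx ?orbT //; congr pair; exact: val_inj.
have win (f : nat -> nat) a : (forall i, f i < 4) -> (forall i, step (f i) (f i.+1)) ->
    mkseq (fun k => f (a + k)) 5 \in windows.
  move=> f4 fS; rewrite mem_filter mem_words /= !f4 !andbT.
  by rewrite !addnS !fS.
have col a b d : d.1 < 5 -> d.2 < 5 -> val (c (pos a b d)) =
    window_color (mkseq (fun k => phi (a + k)) 5) (mkseq (fun k => psi (b + k)) 5) d.
  by move=> d1 d2; rewrite ffunE /= /window_color !nth_mkseq // phiM psiM.
(* 2 * n.-1 plays the role of -2 mod n, so x is the center (2, 2) of its window. *)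
have center (x : 'I_p * 'I_q) :
    x = pos (x.1 + 2 * p.-1) (x.2 + 2 * q.-1) (2, 2).
  have shift n (i : 'I_n) : (i + 2 * n.-1 + 2) %% n = i.
    have i_n := ltn_ord i; have -> : i + 2 * n.-1 + 2 = 2 * n + i by lia.
    by rewrite modnMDl modn_small.
  by case: x => x1 x2; congr pair; apply: val_inj; rewrite /= shift.
(* The lower bounds allow a second use of [lift]; the upper ones keep that second move inside the
   window. *)
have nbrs_near d : d \in nbrs (2, 2) -> [/\ 0 < d.1, d.1 < 4, 0 < d.2 & d.2 < 4].
  by rewrite !inE => /or4P[] /eqP->.
have nbrs_lt5 d d' : d.1 < 4 -> d.2 < 4 -> d' \in nbrs d -> d'.1 < 5 /\ d'.2 < 5.
  by rewrite !inE => d1 d2 /or4P[] /eqP->; split=> /=; lia.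
have win_ok a b :
    window_ok (mkseq (fun k => phi (a + k)) 5) (mkseq (fun k => psi (b + k)) 5).
  exact: (allP (allP windows_ok _ (win _ _ phi4 phiS)) _ (win _ _ psi4 psiS)).
split=> [x y | s us].
  rewrite (center x); set a := x.1 + _; set b := x.2 + _.
  case/lift=> // d /[dup] dn /nbrs_near[_ d1 _ d2] ->.
  have /andP[+ _] := allP (win_ok a b) _ dn; apply: contraNneq => cE.
  by rewrite -(col a b (2, 2)) // -(col a b d) ?cE // leqW.
case: s us => [|x0 [|x1 [|x [|x3 [|x4 [|? ?]]]]]] //= us; try by case: (_ && _).
(* The first two edges are reversed so that both halves of the path lead away from its middle vertex
   [x]. *)
rewrite andbT => /and4P[]; rewrite torus_sym => e10; rewrite torus_sym => e1 e3 e34.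
move: e1 e3 us e10 e34; rewrite (center x); set a := x.1 + _; set b := x.2 + _.
case/lift=> // d1 d1n ->; case/lift=> // d3 d3n ->.
have [d11 d12 d13 d14] := nbrs_near _ d1n.
have [d31 d32 d33 d34] := nbrs_near _ d3n.
move=> us; case/lift=> // d0 d0n x0E; case/lift=> // d4 d4n x4E.
have [d01 d02] := nbrs_lt5 _ _ d12 d14 d0n.
have [d41 d42] := nbrs_lt5 _ _ d32 d34 d4n.
case/andP: (allP (win_ok a b) _ d1n) => _.
move=> /allP/(_ _ d3n)/allP/(_ _ d0n)/allP/(_ _ d4n).
set ds := [:: d0; d1; (2, 2); d3; d4].
(* Distinct vertices have distinct offsets, which is the premise inside [window_ok]. *)
have us' : uniq (map (pos a b) ds) by rewrite /ds /= -x0E -x4E.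
lazy zeta; rewrite (map_uniq us').
have <- : map val (map c (map (pos a b) ds)) =
    map (window_color (mkseq (fun k => phi (a + k)) 5)
                      (mkseq (fun k => psi (b + k)) 5)) ds.
  rewrite -!map_comp; apply/eq_in_map => d dd; apply: col; move: d dd; apply/allP;
  by rewrite /ds /= ?d01 ?d02 ?d41 ?d42 ?(leqW d12, leqW d14) ?(leqW d32, leqW d34).
rewrite alternating_map; last exact: val_inj.
by rewrite x0E x4E.
Qed.

Lemma torus_not_P5_3colorable n : n <= 3 -> ~~ Pk_colorable torus 5 n.
Proof.
move=> n3; apply/negP=> /existsP[c /(P5_coloringP _ torus_sym)[propc P5c]].
have p0 : 0 < p by lia.
have q0 : 0 < q by lia.
pose g k : 'I_p * 'I_q :=
  (Ordinal (ltn_pmod (k %/ 3) p0), Ordinal (ltn_pmod (k %% 3) q0)).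
have gE k : k < 9 -> ((g k).1 = k %/ 3 :> nat) * ((g k).2 = k %% 3 :> nat).
  by move=> k9; split; rewrite /= modn_small; lia.
(* As p and q are at least 3, the reductions modulo p and q leave the grid coordinates unchanged. *)
have g_inj : {in gtn 9 &, injective g}.
  move=> i j; rewrite !inE => i9 j9 gij; have := gE i i9; rewrite gij => -[].
  by rewrite !(gE j j9); lia.
have cyc m (u v : 'I_m) : v = u.+1 :> nat \/ u = v.+1 :> nat -> cycle_rel u v.
  by case=> E; rewrite /cycle_rel /= E eqxx ?orbT.
have g_adj : {in gtn 9 &, {homo g : i j / grid3_adj i j >-> torus i j}}.
  move=> i j; rewrite !inE => i9 j9 /orP[] /andP[/eqP eq_ij adj].
    apply/orP; left; apply/andP; split; first by apply/eqP/ord_inj; rewrite !gE.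
    by apply: cyc; rewrite !gE //; case/orP: adj => /eqP ?; [left | right]; lia.
  apply/orP; right; apply/andP; split; last by apply/eqP/ord_inj; rewrite !gE.
  by apply: cyc; rewrite !gE //; case/orP: adj => /eqP ?; [left | right]; lia.
(* Colors read as naturals below [n <= 3], so one search over three letters serves every such
   [n]. *)
pose w := mkseq (fun k => val (c (g k))) 9.
have wE k s : s \in words 9 k -> map (nth 0 w) s = map val (map c (map g s)).
  rewrite mem_words => /andP[_ /allP s9]; rewrite -!map_comp.
  by apply/eq_in_map => i /s9 i9; rewrite nth_mkseq.
have s_adj k s : s \in words 9 k -> sorted grid3_adj s -> sorted torus (map g s).
  rewrite mem_words sorted_map => /andP[_ s9]; exact: (sub_in_sorted g_adj s9).
apply: (negP grid3_no_P5_3coloring); apply/hasP; exists w.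
  rewrite mem_words size_mkseq eqxx; apply/allP=> _ /mapP[k _ ->].
  exact: leq_trans (ltn_ord _) n3.
apply/andP; split; apply/allP=> s; rewrite mem_filter.
  case/andP=> ss sW; rewrite (wE _ _ sW) map_inj_uniq; last exact: val_inj.
  move: (s_adj _ _ sW ss); rewrite mem_words in sW.
  case: s sW {ss} => [|u [|v [|]]] //= _.
  by rewrite andbT inE => /propc ->.
case/andP=> /andP[ss us] sW; rewrite (wE _ _ sW) alternating_map; last exact: val_inj.
apply: P5c (s_adj _ _ sW ss); move: sW; rewrite mem_words => /andP[_ /allP s9].
by rewrite map_inj_in_uniq // => i j /s9 i9 /s9 j9; apply: g_inj.
Qed.

End Torus.

Theorem theorem10 (p q : nat) (hp : 3 <= p) (hq : 3 <= q)
    (hp5 : p <> 5) (hq5 : q <> 5) :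
  Pk_chromatic_number (box_rel (@cycle_rel p) (@cycle_rel q)) 5 = 4.
Proof.
apply/Pk_chromatic_numberP => //; first exact: torus_irr.
split; first exact: torus_P5_4colorable.
move=> n; apply: contraTT; rewrite -ltnNge; exact: torus_not_P5_3colorable.
Qed.
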